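(* Let $X$ be a finite irretractable cycle set whose displacement group $\mathrm{Dis}(X)$ acts regularly on $X$. Then the congruences of $X$ are in one-to-one correspondence with the ideals of the left brace $\mathcal{G}(X)$ contained in $\mathrm{Dis}(X)$.
   Context: A left quasigroup $(X,\cdot)$ is a non-empty set with a binary operation such that $\sigma_x:y\mapsto x\cdot y$ is bijective for every $x$. A cycle set is a left quasigroup with $(x\cdot y)\cdot(x\cdot z)=(y\cdot x)\cdot(y\cdot z)$ for all $x,y,z$; all cycle sets are assumed non-degenerate, i.e. $x\mapsto x\cdot x$ is bijective. $X$ is irretractable if $\sigma_x=\sigma_y$ implies $x=y$. $\mathcal{G}(X)=\langle\sigma_x\mid x\in X\rangle\le \mathrm{Sym}(X)$, and $\mathrm{Dis}(X)$ is the normal closure of $\{\sigma_x\sigma_y^{-1}\mid x,y\in X\}$ in $\mathcal{G}(X)$. A congruence is an equivalence relation $\sim$ such that $x\sim x'$ and $y\sim y'$ imply $x\cdot y\sim x'\cdot y'$ and $\sigma_x^{-1}(y)\sim\sigma_{x'}^{-1}(y')$. A left brace is a set $B$ with an abelian group $(B,+)$ and a group $(B,\circ)$ such that $x\circ(y+z)+x=x\circ y+x\circ z$. Put $\lambda_x(y):=-x+x\circ y$; then $x\mapsto\lambda_x$ is a homomorphism $(B,\circ)\to\mathrm{Aut}(B,+)$. An ideal of $B$ is a normal subgroup $I$ of $(B,\circ)$ with $\lambda_x(I)\subseteq I$ for all $x\in B$. For a cycle set $X$, $\mathcal{G}(X)$ carries its standard left brace structure: $\circ$ is composition of maps and $+$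 is the unique operation making $\mathcal{G}(X)$ a left brace with $(\mathcal{G}(X),+)$ generated by $\{\sigma_x^{-1}\mid x\in X\}$ and $\lambda_g(\sigma_x^{-1})=\sigma_{g(x)}^{-1}$ for all $g\in\mathcal{G}(X)$, $x\in X$. *)

(* Defs.v *)
(* Relations and subsets are Prop-valued; their equality is extensional by the
   axioms of boolp. *)
From Stdlib Require Import RelationClasses.
From HB Require Import structures.
From mathcomp Require Import all_boot all_fingroup.
From mathcomp Require Import classical_sets functions.

Set Implicit Arguments.
Unset Strict Implicit.
Unset Printing Implicit Defensive.

Local Open Scope group_scope.

Record leftQuasigroup (X : Type) := LeftQuasigroup {
  lq_op :> X -> X -> X;
  lq_inhabited : inhabited X;
  lq_bij : forall x, bijective (lq_op x)
}.

(* Non-degeneracy is part of the definition. *)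
Record cycleSet (X : Type) := CycleSet {
  cs_lq :> leftQuasigroup X;
  cs_cycle : forall x y z,
    cs_lq (cs_lq x y) (cs_lq x z) = cs_lq (cs_lq y x) (cs_lq y z);
  cs_nondegenerate : bijective (fun x => cs_lq x x)
}.

Record leftBrace (B : Type) := LeftBrace {
  badd : B -> B -> B;
  bzero : B;
  bopp : B -> B;
  bcirc : B -> B -> B;
  bone : B;
  binv : B -> B;
  baddA : associative badd;
  baddC : commutative badd;
  badd0 : left_id bzero badd;
  baddN : left_inverse bzero bopp badd;
  bcircA : associative bcirc;
  bcirc1 : left_id bone bcirc;
  bcircV : left_inverse bone binv bcirc;
  bcircD : forall x y z,
    badd (bcirc x (badd y z)) x = badd (bcirc x y) (bcirc x z)
}.

Definition blambda B (L : leftBrace B) (x y : B) : B :=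
  badd L (bopp L x) (bcirc L x y).

Definition add_subgroup B (L : leftBrace B) (H : set B) : Prop :=
  [/\ H (bzero L),
      forall x y, H x -> H y -> H (badd L x y)
    & forall x, H x -> H (bopp L x)].

Definition add_generated B (L : leftBrace B) (S : set B) : Prop :=
  forall H : set B, add_subgroup L H -> (forall x, S x -> H x) ->
  forall x, H x.

Definition circ_normal_subgroup B (L : leftBrace B) (I : set B) : Prop :=
  [/\ I (bone L),
      forall x y, I x -> I y -> I (bcirc L x y),
      forall x, I x -> I (binv L x)
    & forall b x, I x -> I (bcirc L (bcirc L b x) (binv L b))].

Definition brace_ideal B (L : leftBrace B) (I : set B) : Prop :=
  circ_normal_subgroup L I /\ (forall b x, I x -> I (blambda L b x)).

(* Permutations in MathComp multiply from left to right: (s * t) x = t (s x).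
   Hence the composite of maps "u after v" is v * u. *)
Definition compg (gT : finGroupType) (u v : gT) : gT := v * u.

Section FiniteLeftQuasigroup.

Variables (X : finType) (Q : leftQuasigroup X).

Definition sigma (x : X) : {perm X} := perm (bij_inj (lq_bij Q x)).

Definition irretractable : Prop :=
  forall x y, sigma x = sigma y -> x = y.

Definition permG : {group {perm X}} := <<[set sigma x | x : X]>>%G.

(* <<class_support S G>>, generated by the conjugates s ^ g with s in S and
   g in G, is the normal closure of S in G. *)
Definition Dis : {group {perm X}} :=
  <<class_support [set compg (sigma x) (sigma y)^-1 | x : X, y : X] permG>>%G.

Definition congruence (R : X -> X -> Prop) : Prop :=
  Equivalence R /\
  forall x x' y y', R x x' -> R y y' ->
    R (Q x y) (Q x' y') /\ R ((sigma x)^-1 y) ((sigma x')^-1 y').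

Lemma sigma_permG x : sigma x \in permG.
Proof. by apply: mem_gen; apply: imset_f. Qed.

Definition sigmaV (x : X) : subg_of permG := Subg (groupVr (sigma_permG x)).

(* The characterization determines badd L uniquely. *)
Definition standard_brace (L : leftBrace (subg_of permG)) : Prop :=
  [/\ forall u v, bcirc L u v = compg u v,
      add_generated L (range sigmaV)
    & forall g x, blambda L g (sigmaV x) = sigmaV (sgval g x)].

End FiniteLeftQuasigroup.

Definition regular (X : finType) (D : {group {perm X}}) : Prop :=
  [transitive D, on [set: X] | 'P] /\ forall x : X, 'C_D[x | 'P] = 1.

(* Main.v *)
(* To a congruence R associate the group N_R of those d in Dis(X) with d z R z
   for all z, and to an ideal I its orbit relation.  Write s_x for sigma_x^-1.

   A normal subgroup N of (G, o) is an ideal as soon as lambda_n s_x = s_x mod N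
   for n in N: then right addition of s_x, hence of any element, preserves
   congruence modulo N, and so lambda_g n = g o n - g = g - g mod N.
   This applies to N_R.  Conversely lambda_h b = b mod I holds for h in an ideal
   I and any b, which makes the orbit relation of I a congruence.

   Regularity gives that the ideal of the orbit relation of I is I again.  For
   the other composite, fix x; the map d |-> sigma_x o sigma_(d x)^-1 on Dis(X)
   is injective since X is irretractable and Dis(X) is regular, and it sends
   {d | d x R x} into its subset N_R; so both are equal by finiteness. *)
Require Import Defs.
From mathcomp Require Import all_boot all_fingroup.
From mathcomp Require Import boolp classical_sets functions.

Set Implicit Arguments.
Unset Strict Implicit.
Unset Printing Implicit Defensive.

Local Open Scope group_scope.

(** * Left brace identities and elements modulo an ideal *)

Section LeftBrace.

Variables (B : Type) (L : leftBrace B).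
Implicit Types (x y z : B) (I : set B).

Local Notation "x +b y" := (badd L x y) (at level 50, left associativity).
Local Notation "x *b y" := (bcirc L x y) (at level 40, left associativity).
Local Notation "0b" := (bzero L).
Local Notation "-b x" := (bopp L x) (at level 35, right associativity).
Local Notation "x ^b" := (binv L x) (at level 2, format "x ^b").
Local Notation lam := (blambda L).

Lemma baddr0 : right_id 0b (badd L).
Proof. by move=> x; rewrite baddC badd0. Qed.

Lemma baddrN : right_inverse 0b (bopp L) (badd L).
Proof. by move=> x; rewrite baddC baddN. Qed.

Lemma baddNK x y : -b x +b (x +b y) = y.
Proof. by rewrite baddA baddN badd0. Qed.

Lemma baddKN x y : x +b (-b x +b y) = y.
Proof. by rewrite baddA baddrN badd0. Qed.

Lemma badd_injr z x y : x +b z = y +b z -> x = y.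
Proof.
move=> /(congr1 (fun t => t +b -b z)).
by rewrite -!baddA baddrN !baddr0.
Qed.

Lemma bcircKV x y : x^b *b (x *b y) = y.
Proof. by rewrite bcircA bcircV bcirc1. Qed.

Lemma bcircrV : right_inverse (bone L) (binv L) (bcirc L).
Proof.
move=> x; rewrite -[LHS](bcircKV x^b); rewrite (bcircA L x^b x).
by rewrite bcircV bcirc1 bcircV.
Qed.

Lemma bcircr1 : right_id (bone L) (bcirc L).
Proof. by move=> x; rewrite -(bcircV L x) bcircA bcircrV bcirc1. Qed.

Lemma bcircVK x y : x *b (x^b *b y) = y.
Proof. by rewrite bcircA bcircrV bcirc1. Qed.

Lemma binv_uniq x y : x *b y = bone L -> x^b = y.
Proof. by move=> e; rewrite -[RHS](bcircKV x) e bcircr1. Qed.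

Lemma bone_bzero : bone L = 0b.
Proof.
have := bcircD L (bone L) 0b 0b; rewrite !bcirc1 badd0 => e.
by rewrite -e badd0.
Qed.

Lemma bcircE x y : x *b y = x +b lam x y.
Proof. by rewrite /blambda baddKN. Qed.

Lemma blambda1 x : lam (bone L) x = x.
Proof. by rewrite -[RHS](bcirc1 L) bcircE {2}bone_bzero badd0. Qed.

Lemma blambdaM x y z : lam (x *b y) z = lam x (lam y z).
Proof.
have e : x *b (y *b z) = x *b y +b lam x (lam y z).
  rewrite (bcircE y z) /(blambda L x) (baddC L (-b x)) baddA -bcircD.
  by rewrite -baddA baddrN baddr0.
by rewrite {1}/blambda -bcircA e baddNK.
Qed.

Lemma blambdaVK x y : lam x (lam x^b y) = y.
Proof. by rewrite -blambdaM bcircrV blambda1. Qed.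

Lemma baddE x y : x +b y = x *b lam x^b y.
Proof. by rewrite bcircE blambdaVK. Qed.

Lemma boppE x : -b x = lam x x^b.
Proof. by rewrite /blambda bcircrV bone_bzero baddr0. Qed.

Lemma ideal_add I x y : brace_ideal L I -> I x -> I y -> I (x +b y).
Proof.
move=> [[_ IM _ _] Il] Ix Iy.
by rewrite baddE; apply: (IM _ _ Ix); apply: Il.
Qed.

Lemma ideal_opp I x : brace_ideal L I -> I x -> I (-b x).
Proof. by move=> [[_ _ IV _] Il] Ix; rewrite boppE; apply/Il/IV. Qed.

(** With [x' = y^-1 o x o y] in [I] by normality, [x o y = y o x' = y + lam y x']. Hence
    [lam x y = y + i] with [i = -x + lam y x'] in [I], and [y^-1 o (y + i) = lam y^-1 i]. *)
Lemma ideal_blambda_mod I x y :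
  brace_ideal L I -> I x -> I (y^b *b lam x y).
Proof.
move=> idI Ix; have [[I1 IM IV IJ] Il] := idI.
have Ixy : I (y^b *b x *b y).
  by have := IJ y^b x Ix; rewrite (_ : y^b^b = y) //; apply/binv_uniq/bcircV.
have -> : lam x y = y +b (-b x +b lam y (y^b *b x *b y)).
  by rewrite (baddC L (-b x)) baddA -bcircE -bcircA bcircVK baddC.
rewrite baddE bcircKV; apply: (Il); apply: ideal_add => //; last exact: Il.
exact: ideal_opp.
Qed.

End LeftBrace.

(** * Recognising ideals from additive generators *)

Lemma brace_ideal_criterion (B : finType) (L : leftBrace B) (S N : set B) :
  add_generated L S ->
  (forall b s, S s -> S (blambda L b s)) ->
  circ_normal_subgroup L N ->
  (forall n s, N n -> S s -> N (bcirc L (binv L s) (blambda L n s))) ->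
  brace_ideal L N.
Proof.
move=> genS lamS nsN lamN; split=> //; case: (nsN) => N1 NM NV NJ.
pose addN : set B := fun b => forall a n, N n -> exists2 m, N m &
  badd L (bcirc L a n) b = bcirc L (badd L a b) m.
have add_all : forall b, addN b.
  apply: genS => [|s Ss a n Nn].
    split=> [a n Nn|b c Hb Hc a n Nn|b Hb].
    - by exists n; rewrite ?baddr0.
    - have [m Nm e] := Hb a n Nn.
      have [k Nk e'] := Hc (badd L a b) m Nm.
      by exists k; rewrite // !baddA e e'.
    - (* Adding b permutes the finite set of pairs congruent modulo N. *)
      pose E := [set p : B * B | `[< N (bcirc L (binv L p.1) p.2) >]].
      pose t (p : B * B) := (badd L p.1 b, badd L p.2 b).
      have t_inj : injective t.
        by move=> [p q] [p' q'] [/(@badd_injr _ L)-> /(@badd_injr _ L)->].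
      have tE : t @: E \subset E.
        apply/fintype.subsetP => q /imsetP[p].
        rewrite finset.in_set => /asboolP Np ->; rewrite finset.in_set.
        have [m Nm] := (Hb p.1 _ Np); rewrite bcircVK => e.
        by apply/asboolP; rewrite /= e bcircKV.
      have {}tE : t @: E = E.
        by apply/eqP; rewrite eqEcard tE card_imset //=.
      move=> a n Nn.
      have : (a, bcirc L a n) \in E.
        by rewrite finset.in_set; apply/asboolP; rewrite bcircKV.
      rewrite -tE => /imsetP[[p q]].
      rewrite finset.in_set => /asboolP /= Npq [-> ->].
      rewrite -!baddA baddrN !baddr0.
      by exists (bcirc L (binv L p) q); rewrite ?bcircVK.
  (* Here [a + s = a o r] and [a o n + s = a o n o lam n^-1 r], so [m] has to be
     [r^-1 o n o lam n^-1 r]. It is split below into a conjugate of [n] and an instance of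
     [lamN]. *)
  pose r := blambda L (binv L a) s.
  have Sr : S r by apply: lamS.
  exists (bcirc L (bcirc L (bcirc L (binv L r) n) (binv L (binv L r)))
            (bcirc L (binv L r) (blambda L (binv L n) r))).
    by apply: NM; [apply: NJ | apply: lamN => //; apply: NV].
  have -> : binv L (binv L r) = r by apply/binv_uniq/bcircV.
  rewrite !baddE -/r -!bcircA !bcircVK; congr (bcirc L a (bcirc L n _)).
  rewrite /r -blambdaM; congr blambda.
  by apply: binv_uniq; rewrite -bcircA bcircVK bcircrV.
(* Adding [-b] to [b o n] gives [(b - b) o m = m]. *)
move=> b n Nn; have [m Nm e] := add_all (bopp L b) b n Nn.
by rewrite /blambda baddC e baddrN -bone_bzero bcirc1.
Qed.

(** * Congruences and ideals of the standard brace *)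

Section Correspondence.

Variables (X : finType) (C : cycleSet X) (L : leftBrace (subg_of (permG C))).
Hypothesis stdL : standard_brace L.

Local Notation B := (subg_of (permG C)).
Local Notation s := (sigmaV C).

Lemma bcirc_val (u v : B) : sgval (bcirc L u v) = sgval v * sgval u.
Proof. by case: stdL => -> _ _. Qed.

Lemma bone_val : sgval (bone L) = 1.
Proof.
apply: (mulgI (sgval (bone L))).
by rewrite -bcirc_val bcirc1 mulg1.
Qed.

Lemma binv_val (u : B) : sgval (binv L u) = (sgval u)^-1.
Proof. by apply/eqP; rewrite eq_sym eq_invg_mul -bcirc_val bcircV bone_val. Qed.

(** This links the brace to the cycle set: the quotient of [lam u s_x] by [s_x] is the displacement
    sigma_x after the inverse of sigma_(u x). *)
Lemma binv_sigmaV_blambda_val (u : B) x :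
  sgval (bcirc L (binv L (s x)) (blambda L u (s x)))
  = (sigma C (sgval u x))^-1 * sigma C x.
Proof.
by case: stdL => _ _ lamE; rewrite lamE bcirc_val binv_val /= invgK.
Qed.

Lemma Dis_norm : permG C \subset 'N(Dis C).
Proof. by apply: norms_gen; apply: class_support_norm. Qed.

Lemma Dis_quotient x y : (sigma C y)^-1 * sigma C x \in Dis C.
Proof.
apply: mem_gen; rewrite -[_ * _]conjg1; apply/imset2P.
exists ((sigma C y)^-1 * sigma C x) 1; rewrite ?group1 ?conjg1 //.
by apply/imset2P; exists x y.
Qed.

Lemma congruence_perm R g x y :
  congruence C R -> g \in permG C -> R x y -> R (g x) (g y).
Proof.
move=> [eqR cR] gG; have [refR _ _] := eqR.
pose K := [set g : {perm X} | `[< forall x y, R x y -> R (g x) (g y) >]].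
suff /fintype.subsetP/(_ g gG) : permG C \subset K.
  by rewrite inE => /asboolP; apply.
(* Closure under products suffices, the symmetric group being finite. *)
have gK : group_set K.
  apply/group_setP; split=> [|a b]; rewrite !inE.
    by apply/asboolP=> u v; rewrite !perm1.
  move=> /asboolP Ka /asboolP Kb; apply/asboolP=> u v Ruv; rewrite !permM.
  by apply/Kb/Ka.
rewrite (gen_subG _ (Group gK)); apply/fintype.subsetP => _ /imsetP[z _ ->].
rewrite inE; apply/asboolP => u v Ruv; rewrite !permE.
by case: (cR z z u v (refR z) Ruv).
Qed.

Definition Dis_ker (R : X -> X -> Prop) : set B :=
  fun u => sgval u \in Dis C /\ forall z, R (sgval u z) z.

Definition orbit_rel (I : set B) (x y : X) : Prop :=
  exists2 u, I u & sgval u x = y.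

Lemma Dis_circ_normal :
  circ_normal_subgroup L (fun u => sgval u \in Dis C).
Proof.
split=> [|u v|u|b u] /=; rewrite ?bone_val ?bcirc_val ?binv_val ?group1 //.
- by move=> uD vD; rewrite groupM.
- by rewrite groupV.
move=> uD; have bN : sgval b \in 'N(Dis C).
  exact: (fintype.subsetP Dis_norm _ (valP b)).
by have := memJ_norm (sgval u) bN; rewrite uD.
Qed.

Lemma standard_ideal (N : set B) :
  circ_normal_subgroup L N ->
  (forall u x, N u -> N (bcirc L (binv L (s x)) (blambda L u (s x)))) ->
  brace_ideal L N.
Proof.
case: stdL => _ genS lamE nsN lamN.
apply: (brace_ideal_criterion genS) => // [b _ [x _ <-]|u _ Nu [x _ <-]].
  by rewrite lamE; exists (sgval b x).
exact: lamN.
Qed.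

(** Apply sigma_x to the related points sigma_y^-1 z and sigma_x^-1 z. *)
Lemma Dis_ker_quotient R x y z : congruence C R -> R x y ->
  R (((sigma C y)^-1 * sigma C x) z) z.
Proof.
move=> cR Rxy; have [[refR symR _] cR2] := cR.
rewrite permM -[X in R _ X](permKV (sigma C x)).
apply: congruence_perm => //; first exact: sigma_permG.
by apply: (cR2 _ _ _ _ _ _).2; [apply: symR | apply: refR].
Qed.

Lemma Dis_ker_ideal R : congruence C R -> brace_ideal L (Dis_ker R).
Proof.
move=> cR; have [[refR symR trR] _] := cR.
have [D1 DM DV DJ] := Dis_circ_normal.
apply: standard_ideal.
  split=> [|u v [uD uR] [vD vR]|u [uD uR]|b u [uD uR]]; split.
  - exact: D1.
  - by move=> z; rewrite bone_val perm1.
  - exact: DM.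
  - by move=> z; rewrite bcirc_val permM; apply: trR (uR _) (vR z).
  - exact: DV.
  - move=> z; rewrite binv_val; apply: symR.
    by rewrite -{1}[z](permKV (sgval u)).
  - exact: DJ.
  - move=> z; rewrite !bcirc_val binv_val !permM.
    rewrite -[X in R _ X](permKV (sgval b)).
    by apply: congruence_perm; first exact: cR; last exact: uR; exact: valP.
move=> u x [uD uR]; split; rewrite binv_sigmaV_blambda_val.
  exact: Dis_quotient.
by move=> z; apply: Dis_ker_quotient => //; apply: symR.
Qed.

Lemma orbit_rel_congruence I : brace_ideal L I -> congruence C (orbit_rel I).
Proof.
move=> idI; have [[I1 IM IV IJ] Il] := idI.
have refI x : orbit_rel I x x by exists (bone L); rewrite // bone_val perm1.
have symI x y : orbit_rel I x y -> orbit_rel I y x.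
  by move=> [u Iu <-]; exists (binv L u); [apply: IV | rewrite binv_val permK].
have trI x y z : orbit_rel I x y -> orbit_rel I y z -> orbit_rel I x z.
  move=> [u Iu <-] [v Iv <-]; exists (bcirc L v u); first exact: IM.
  by rewrite bcirc_val permM.
have actI (b : B) (x y : X) :
    orbit_rel I x y -> orbit_rel I (sgval b x) (sgval b y).
  move=> [u Iu <-]; exists (bcirc L (bcirc L b u) (binv L b)); first exact: IJ.
  by rewrite !bcirc_val binv_val !permM permK.
(* For x' = u x, sigma_x' is sigma_x up to [v] in [I]: sigma_x'^-1 z = sigma_x^-1 (v z), and v z
   lies in the orbit of z. *)
have sV x x' z : orbit_rel I x x' ->
    orbit_rel I ((sigma C x)^-1 z) ((sigma C x')^-1 z).
  move=> [u Iu <-]; have := ideal_blambda_mod (s x) idI Iu.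
  set v := bcirc L _ _ => Iv.
  have e : sgval v = (sigma C (sgval u x))^-1 * sigma C x.
    exact: binv_sigmaV_blambda_val.
  have -> : (sigma C (sgval u x))^-1 z = sgval (s x) (sgval v z).
    by rewrite e permM /= permK.
  by apply: (actI (s x)); exists v.
split; first by split=> //; exact: trI.
move=> x x' y y' xx' yy'; split; last first.
  by apply: trI (sV _ _ _ xx'); apply: (actI (s x)).
have := actI (subg (permG C) (sigma C x)) _ _ yy'.
rewrite !subgK ?sigma_permG // !permE => /trI; apply.
(* The case of sigma follows from that of its inverse: at the point x'.y', [sV] relates sigma_x^-1
   (x'.y') to y'; now apply sigma_x. *)
have := sV _ _ (C x' y') xx' => /(actI (subg (permG C) (sigma C x))).
rewrite subgK ?sigma_permG // permKV.
have -> : (sigma C x')^-1 (C x' y') = y'.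
  by apply: (@perm_inj _ (sigma C x')); rewrite permKV permE.
by rewrite [sigma C x y']permE; apply: symI.
Qed.

(** * The two composites, under regularity *)

Hypotheses (irrC : irretractable C) (regC : regular (Dis C)).

Lemma regular_inj d e x : d \in Dis C -> e \in Dis C -> d x = e x -> d = e.
Proof.
move=> dD eD de; apply/eqP; rewrite eq_mulgV1; apply/eqP/set1gP.
rewrite -(regC.2 x) inE groupM ?groupV //=.
by apply/astab1P; rewrite /= apermE permM de permK.
Qed.

Lemma regular_ex x y : exists2 d, d \in Dis C & d x = y.
Proof.
have := atransP2 regC.1 (finset.in_setT x) (finset.in_setT y).
by move=> [d dD ->]; exists d.
Qed.

Lemma orbit_relK I :
  brace_ideal L I -> (forall u, I u -> sgval u \in Dis C) ->
  Dis_ker (orbit_rel I) = I.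
Proof.
move=> idI ID; have [eqI _] := orbit_rel_congruence idI.
have [refI symI _] := eqI.
rewrite predeqE => u; split=> [[uD uI]|Iu]; last first.
  by split=> [|z]; [apply: ID | apply: symI; exists u].
case: C.(cs_lq).(lq_inhabited) => x.
(* Some [v] in [I] agrees with [u] at the single point x; as the action is free, that forces u =
   v. *)
have [v Iv vx] := symI _ _ (uI x).
suff -> : u = v by [].
by apply/val_inj/(regular_inj (x := x)) => //; apply: ID.
Qed.

Lemma Dis_ker_stable R d x : congruence C R ->
  d \in Dis C -> R (d x) x -> forall z, R (d z) z.
Proof.
move=> cR dD Rdx; have [[_ symR _] _] := cR.
pose S := [set e in Dis C | `[< R (e x) x >]].
pose N := [set e in Dis C | `[< forall z, R (e z) z >]].
pose f (e : {perm X}) := (sigma C (e x))^-1 * sigma C x.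
have f_inj : {in S &, injective f}.
  move=> a b; rewrite !finset.in_set => /andP[aD _] /andP[bD _] e.
  (* Cancelling sigma_x leaves sigma_(a x) = sigma_(b x), hence a x = b x by irretractability. *)
  by move/mulIg/invg_inj/irrC: e; exact: regular_inj.
have fS : f @: S \subset N.
  apply/fintype.subsetP => _ /imsetP[e eS ->].
  move: eS; rewrite !finset.in_set => /andP[eD /asboolP Re].
  rewrite Dis_quotient; apply/asboolP => z.
  by apply: Dis_ker_quotient => //; apply: symR.
have NS : N \subset S.
  apply/fintype.subsetP => e; rewrite !finset.in_set => /andP[-> /asboolP Re].
  exact/asboolP.
have /eqP NeS : N == S.
  by rewrite eqEcard NS -(card_in_imset f_inj) subset_leq_card.
have : d \in S by rewrite finset.in_set dD; apply/asboolP.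
by rewrite -NeS finset.in_set => /andP[_ /asboolP].
Qed.

Lemma Dis_kerK R : congruence C R -> orbit_rel (Dis_ker R) = R.
Proof.
move=> cR; have [[_ symR _] _] := cR.
rewrite predeq2E => x y; split=> [[u [_ uR] <-]|Rxy]; first exact: symR.
(* Transitivity supplies [d] carrying x to y; it relates one point to its image, hence by
   [Dis_ker_stable] every point. *)
have [d dD dx] := regular_ex x y.
have dG : d \in permG C.
  have sub : Dis C \subset permG C.
    rewrite gen_subG class_support_subG //; apply/fintype.subsetP.
    move=> _ /imset2P[a b _ _ ->].
    by rewrite /compg groupM ?groupV ?sigma_permG.
  exact: (fintype.subsetP sub).
exists (subg (permG C) d); rewrite ?subgK //; split; rewrite subgK //.
by apply: (Dis_ker_stable (x := x)) => //; rewrite dx; apply: symR.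
Qed.

End Correspondence.

Theorem theorem35 (X : finType) (C : cycleSet X)
    (L : leftBrace (subg_of (permG C))) :
  standard_brace L ->
  irretractable C ->
  regular (Dis C) ->
  exists f : (X -> X -> Prop) -> set (subg_of (permG C)),
    set_bij
      (fun R => congruence C R)
      (fun I => brace_ideal L I /\ forall u, I u -> sgval u \in Dis C)
      f.
Proof.
move=> stdL irrC regC; exists (@Dis_ker X C); split.
- by move=> R cR; split=> [|u []//]; apply: (Dis_ker_ideal stdL).
- move=> R R' /set_mem cR /set_mem cR' e.
  by rewrite -(Dis_kerK irrC regC cR) e (Dis_kerK irrC regC cR').
- move=> I [idI ID]; exists (orbit_rel I); last exact: (orbit_relK stdL).
  exact: (orbit_rel_congruence stdL).
Qed.
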